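(* For all $n\ge2$ and $P,Q\in\Gamma_n$, $$\mathcal W_s(P\Vert Q)\le\tfrac18J(P\Vert Q)\quad\text{for } -2\le s\le0,\qquad \mathcal W_s(P\Vert Q)\ge\tfrac18J(P\Vert Q)\quad\text{for } s\ge1.$$
   Context: $\Gamma_n=\{P=(p_1,\dots,p_n): p_i>0,\ \sum_{i=1}^n p_i=1\}$. For $P,Q\in\Gamma_n$, $J(P\Vert Q)=\sum_{i=1}^n(p_i-q_i)\ln(p_i/q_i)$ and $$\mathcal W_s(P\Vert Q)=\begin{cases}[s(s-1)]^{-1}\left[\sum_{i=1}^n\left(\frac{p_i^{1-s}+q_i^{1-s}}{2}\right)\left(\frac{p_i+q_i}{2}\right)^s-1\right], & s\ne0,1,\\ \frac12\left[\sum_{i=1}^n p_i\ln\left(\frac{2p_i}{p_i+q_i}\right)+\sum_{i=1}^n q_i\ln\left(\frac{2q_i}{p_i+q_i}\right)\right], & s=0,\\ \sum_{i=1}^n\left(\frac{p_i+q_i}{2}\right)\ln\left(\frac{p_i+q_i}{2\sqrt{p_iq_i}}\right), & s=1.\end{cases}$$ *)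

(* Defs.v *)
From mathcomp Require Import all_boot all_order all_algebra.
From mathcomp Require Import all_classical all_reals all_analysis.

Set Implicit Arguments.
Unset Strict Implicit.
Unset Printing Implicit Defensive.

Import Order.TTheory GRing.Theory Num.Theory.

Local Open Scope classical_set_scope.
Local Open Scope ring_scope.

Definition Gamma (R : realType) (n : nat) : set 'rV[R]_n :=
  [set P : 'rV[R]_n | (forall i : 'I_n, 0 < P 0 i) /\ \sum_(i < n) P 0 i = 1].

Arguments Gamma : clear implicits.

Definition Jdiv {R : realType} {n : nat} (P Q : 'rV[R]_n) : R :=
  \sum_(i < n) (P 0 i - Q 0 i) * ln (P 0 i / Q 0 i).

(* On Gamma n every base of a power is positive, so that [a `^ x] is
   [expR (x * ln a)] there. *)
Definition Wdiv {R : realType} {n : nat} (s : R) (P Q : 'rV[R]_n) : R :=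
  if s == 0 then
    2^-1 * (\sum_(i < n) P 0 i * ln (2 * P 0 i / (P 0 i + Q 0 i)) +
            \sum_(i < n) Q 0 i * ln (2 * Q 0 i / (P 0 i + Q 0 i)))
  else if s == 1 then
    \sum_(i < n) (P 0 i + Q 0 i) / 2 *
      ln ((P 0 i + Q 0 i) / (2 * Num.sqrt (P 0 i * Q 0 i)))
  else
    (s * (s - 1))^-1 *
      ((\sum_(i < n) (P 0 i `^ (1 - s) + Q 0 i `^ (1 - s)) / 2 *
                     ((P 0 i + Q 0 i) / 2) `^ s) - 1).

(* Main.v *)
Require Import Defs.
From mathcomp Require Import all_boot all_order all_algebra.
From mathcomp Require Import all_classical all_reals all_analysis.
From mathcomp Require Import ring lra.

Import Order.TTheory GRing.Theory Num.Theory.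

Local Open Scope ring_scope.

(** Write m = (p + q) / 2 and t = (p - q) / (p + q), so that p = m (1 + t),
    q = m (1 - t) and -1 < t < 1.  Once the 1 in [Wdiv] is written as the sum
    of the m, the terms of both divergences are homogeneous of degree one in
    (p, q), hence equal to m times an even function of t: [Wdiv_Wker] and
    [Jdiv_Jker].  It remains to compare the two even functions [Wker s] and
    [Jker] on ]-1, 1[.

    Both vanish at 0 together with their first derivatives, and their second
    derivatives are, with a = - s - 1,
    - ((1 + t)^a + (1 - t)^a) / 2 for [Wker s], uniformly in s, the
      exceptional values 0 and 1 included;
    - (1 - t^2)^-2 for [Jker].
    So the sign of the difference of these second derivatives decides.  When
    -2 <= s <= 0, that is -1 <= a <= 1, the first is the smaller one
    ([powR_pair_le]); when s >= 1, that is a <= -2, it is the larger one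
    ([powR_pair_ge]).  Both facts come from Bernoulli's inequality for real
    exponents.  The two kernels agree to second order at 0, which explains the
    factor 1/8. *)

(** * Bernoulli's inequality and the comparison of second derivatives *)

(** Convexity of the exponential between [ln x] and 0, with weights a and
    1 - a. *)
Lemma powR_bernoulli_le (R : realType) (a x : R) :
  0 <= a <= 1 -> 0 < x -> x `^ a <= 1 + a * (x - 1).
Proof.
move=> /andP[a0 a1] x0.
rewrite /powR gt_eqF//.
have := convex_expR (Itv01 a0 a1) (ln x) 0.
rewrite !convRE /= expR0 lnK// mulr0 addr0 mulr1.
by rewrite /unstable.onem; lra.
Qed.

(** The concave case applied to [x `^ a] and the exponent [a^-1]. *)
Lemma powR_bernoulli_ge (R : realType) (a x : R) :
  1 <= a -> 0 < x -> 1 + a * (x - 1) <= x `^ a.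
Proof.
move=> a1 x0.
have a0 : 0 < a by lra.
have ia : 0 <= a^-1 <= 1 by rewrite invr_ge0 ltW//= invf_le1.
have := @powR_bernoulli_le _ _ _ ia (powR_gt0 a x0).
rewrite -powRrM mulfV ?gt_eqF// powRr1; last exact: ltW.
rewrite -(ler_pM2l a0) mulrDr mulrA mulfV ?gt_eqF//; lra.
Qed.

(** For 0 <= b <= 1, Bernoulli bounds (1 + t)^b + (1 - t)^b by 2, the linear
    terms cancelling.  This settles a >= 0, since (1 - t^2)^-2 >= 1.  A negative
    exponent a is reduced to - a at the price of the factor (1 - t^2)^a, which
    is at most (1 - t^2)^-2. *)
Lemma powR_pair_le (R : realType) (a t : R) :
  -1 <= a <= 1 -> -1 < t < 1 ->
  ((1 + t) `^ a + (1 - t) `^ a) / 2 <= ((1 - t ^+ 2) ^+ 2)^-1.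
Proof.
move=> /andP[a0 a1] /andP[t0 t1].
have xp : 0 < 1 + t by lra.
have yp : 0 < 1 - t by lra.
have E : 1 - t ^+ 2 = (1 + t) * (1 - t) by ring.
have m0 : 0 < 1 - t ^+ 2 by rewrite E mulr_gt0.
have m1 : 1 - t ^+ 2 <= 1 by have := sqr_ge0 t; lra.
have B b : 0 <= b <= 1 -> (1 + t) `^ b + (1 - t) `^ b <= 2.
  move=> hb; have := @powR_bernoulli_le _ _ _ hb xp.
  by have := @powR_bernoulli_le _ _ _ hb yp; lra.
have I (b : R) : -2 <= b -> (1 - t ^+ 2) `^ b <= ((1 - t ^+ 2) ^+ 2)^-1.
  by move=> hb; rewrite -powR_invn ?(ltW m0)// ger_powR ?m0.
have [ap|an] := leP 0 a.
  have := B a; rewrite ap a1 => /(_ isT) {}B.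
  have := I 0; rewrite powRr0; lra.
have := B (- a); have -> : 0 <= - a <= 1 by lra.
move=> /(_ isT) {}B.
(* x^a + y^a = (x y)^a (x^(-a) + y^(-a)) *)
have -> : (1 + t) `^ a + (1 - t) `^ a =
    (1 - t ^+ 2) `^ a * ((1 + t) `^ (- a) + (1 - t) `^ (- a)).
  rewrite E powRM ?(ltW xp) ?(ltW yp)// !powRN; field.
  by rewrite !gt_eqF ?powR_gt0.
apply: le_trans (I a _); last lra.
rewrite -mulrA ler_piMr ?powR_ge0//; lra.
Qed.

(** The bound holds at a = -2, where the left-over factor is 1 + t^2.  For
    a <= -2, Bernoulli with exponent c = - a / 2 >= 1, applied to
    (1 + t)^-2 and (1 - t)^-2, reduces to that case, because the mean of these
    two numbers is at least 1. *)
Lemma powR_pair_ge (R : realType) (a t : R) :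
  a <= -2 -> -1 < t < 1 ->
  ((1 - t ^+ 2) ^+ 2)^-1 <= ((1 + t) `^ a + (1 - t) `^ a) / 2.
Proof.
move=> a2 /andP[t0 t1].
have xp : 0 < 1 + t by lra.
have yp : 0 < 1 - t by lra.
have E : 1 - t ^+ 2 = (1 + t) * (1 - t) by ring.
have m0 : 0 < 1 - t ^+ 2 by rewrite E mulr_gt0.
have t2 := sqr_ge0 t.
pose c := - a / 2.
have c1 : 1 <= c by rewrite /c; lra.
have B x : 0 < x -> 1 + c * (x ^- 2 - 1) <= x `^ a.
  move=> x0; have x20 : 0 < x ^- 2 by rewrite invr_gt0 exprn_gt0.
  have := @powR_bernoulli_ge _ _ _ c1 x20.
  rewrite -powR_invn ?(ltW x0)// -powRrM.
  by have -> : - 2%:R * c = a by rewrite /c; field.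
set M := ((1 - t ^+ 2) ^+ 2)^-1.
have M1 : 1 <= M.
  by rewrite /M invf_ge1 ?exprn_gt0// expr_le1 ?(ltW m0)//; lra.
have S : (1 + t) ^- 2 + (1 - t) ^- 2 = 2 * (1 + t ^+ 2) * M.
  by rewrite /M E; field; rewrite !gt_eqF.
have tM : 0 <= t ^+ 2 * M by rewrite mulr_ge0//; lra.
have := B _ xp; have := B _ yp.
have : 0 <= (c - 1) * (2 * (1 + t ^+ 2) * M - 2).
  by rewrite mulr_ge0//; lra.
rewrite -S; lra.
Qed.

(** * Positivity from the second derivative *)

(** The condition [0 <= c * t] says that c lies on the same side of 0 as t, so
    that two successive applications yield a product of the form
    [f'' d * (c * t)] whose sign is that of f''. *)
Lemma MVT_origin (R : realType) (f df : R -> R) (r t : R) :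
  (forall x, -r < x < r -> is_derive x 1 f (df x)) -> -r < t < r ->
  exists c, [/\ -r < c < r, 0 <= c * t & f t = f 0 + df c * t].
Proof.
move=> fd /andP[rt tr].
have [t0|t0] := leP 0 t.
  have [||c] := @MVT_segment _ f df 0 t t0.
  - by move=> x; rewrite in_itv /= => hx; apply: fd; lra.
  - apply: derivable_within_continuous => x; rewrite in_itv /= => hx.
    by apply: ex_derive; apply: fd; lra.
  rewrite in_itv /= => /andP[c0 ct] e; exists c; split; first lra.
    by rewrite mulr_ge0.
  by rewrite -[f t](subrK (f 0)) e; ring.
have [||c] := @MVT_segment _ f df t 0 (ltW t0).
- by move=> x; rewrite in_itv /= => hx; apply: fd; lra.
- apply: derivable_within_continuous => x; rewrite in_itv /= => hx.
  by apply: ex_derive; apply: fd; lra.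
rewrite in_itv /= => /andP[c0 ct] e; exists c; split; first lra.
  by rewrite mulr_le0// ltW.
by rewrite -[f t](subKr (f 0)) e; ring.
Qed.

Lemma ge0_of_second_derivative (R : realType) (f df ddf : R -> R) (r t : R) :
  (forall x, -r < x < r -> is_derive x 1 f (df x)) ->
  (forall x, -r < x < r -> is_derive x 1 df (ddf x)) ->
  f 0 = 0 -> df 0 = 0 -> (forall x, -r < x < r -> 0 <= ddf x) ->
  -r < t < r -> 0 <= f t.
Proof.
move=> fd dfd f0 df0 dd0 ht.
have [c [hc ct ->]] := @MVT_origin _ _ _ _ _ fd ht.
have [d [hd dc ->]] := @MVT_origin _ _ _ _ _ dfd hc.
by rewrite f0 df0 !add0r -mulrA mulr_ge0// dd0.
Qed.

(** * The two kernels and their derivatives *)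

(** A function with second derivative x^(- s - 1) for every s, that vanishes at
    1; a multiple of x - 1 could be added, as it would cancel in [Wker]. *)
Definition powgen {R : realType} (s x : R) : R :=
  if s == 0 then x * ln x
  else if s == 1 then - ln x
  else (s * (s - 1))^-1 * (x `^ (1 - s) - 1).

(** The value s = 1 needs no case of its own: both formulas for [powgen]
    differentiate to the power law below. *)
Definition dpowgen {R : realType} (s x : R) : R :=
  if s == 0 then ln x + 1 else - s^-1 * x `^ (- s).

Lemma is_derive_powgen (R : realType) (s x : R) : 0 < x ->
  is_derive x 1 (powgen s) (dpowgen s x).
Proof.
move=> x0; have dl := is_derive1_ln x0.
rewrite /dpowgen /powgen.
case: eqP => [_|/eqP s0].
  apply: is_derive_eq; rewrite /GRing.scale /= mulfV ?gt_eqF//; ring.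
case: eqP => [->|/eqP s1].
  apply: is_derive_eq; rewrite powR_inv1 ?(ltW x0)// invr1; ring.
have dp := is_derive1_powR (1 - s) x0.
apply: is_derive_eq; rewrite /GRing.scale /= addrAC subrr add0r.
by field; rewrite s0 subr_eq0.
Qed.

Lemma is_derive_dpowgen (R : realType) (s x : R) : 0 < x ->
  is_derive x 1 (dpowgen s) (x `^ (- s - 1)).
Proof.
move=> x0; have dl := is_derive1_ln x0.
rewrite /dpowgen.
case: eqP => [->|/eqP s0].
  by apply: is_derive_eq; rewrite oppr0 add0r powR_inv1 ?(ltW x0)// addr0.
have dp := is_derive1_powR (- s) x0.
apply: is_derive_eq; rewrite /GRing.scale /=.
by field.
Qed.

Lemma is_derive_1D (R : realType) (g : R -> R) (t d : R) :
  is_derive (1 + t) 1 g d -> is_derive t 1 (fun u => g (1 + u)) d.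
Proof.
move=> dg.
have dt : is_derive t 1 (fun u : R => 1 + u) 1.
  by have := is_deriveD (is_derive_cst (1 : R) t 1) (is_derive_id t 1);
    rewrite add0r.
by have := @is_derive1_comp _ g (fun u => 1 + u) t d 1 dg dt; rewrite mulr1.
Qed.

Lemma is_derive_1B (R : realType) (g : R -> R) (t d : R) :
  is_derive (1 - t) 1 g d -> is_derive t 1 (fun u => g (1 - u)) (- d).
Proof.
move=> dg.
have dt : is_derive t 1 (fun u : R => 1 - u) (- 1).
  by have := is_deriveB (is_derive_cst (1 : R) t 1) (is_derive_id t 1);
    rewrite add0r.
by have := @is_derive1_comp _ g (fun u => 1 - u) t d (- 1) dg dt;
  rewrite mulrN1.
Qed.

(** [Wdiv] per unit of mean mass, for the pair (1 + t, 1 - t). *)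
Definition Wker {R : realType} (s t : R) : R :=
  (powgen s (1 + t) + powgen s (1 - t)) / 2.

Definition dWker {R : realType} (s t : R) : R :=
  (dpowgen s (1 + t) - dpowgen s (1 - t)) / 2.

(** One eighth of [Jdiv] per unit of mean mass, for the pair (1 + t, 1 - t). *)
Definition Jker {R : realType} (t : R) : R :=
  t / 4 * (ln (1 + t) - ln (1 - t)).

Definition dJker {R : realType} (t : R) : R :=
  (ln (1 + t) - ln (1 - t)) / 4 + t / 4 * ((1 + t)^-1 + (1 - t)^-1).

Lemma is_derive_Wker (R : realType) (s t : R) : -1 < t < 1 ->
  is_derive t 1 (Wker s) (dWker s t).
Proof.
move=> /andP[t0 t1].
have d1 : is_derive t 1 (fun u => powgen s (1 + u)) (dpowgen s (1 + t)).
  by apply/is_derive_1D/is_derive_powgen; lra.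
have d2 : is_derive t 1 (fun u => powgen s (1 - u)) (- dpowgen s (1 - t)).
  by apply/is_derive_1B/is_derive_powgen; lra.
rewrite /Wker /dWker; apply: is_derive_eq; rewrite /GRing.scale /=; ring.
Qed.

Lemma is_derive_dWker (R : realType) (s t : R) : -1 < t < 1 ->
  is_derive t 1 (dWker s) (((1 + t) `^ (- s - 1) + (1 - t) `^ (- s - 1)) / 2).
Proof.
move=> /andP[t0 t1].
have d1 : is_derive t 1 (fun u => dpowgen s (1 + u)) ((1 + t) `^ (- s - 1)).
  by apply/is_derive_1D/is_derive_dpowgen; lra.
have d2 : is_derive t 1 (fun u => dpowgen s (1 - u)) (- (1 - t) `^ (- s - 1)).
  by apply/is_derive_1B/is_derive_dpowgen; lra.
rewrite /dWker; apply: is_derive_eq; rewrite /GRing.scale /=; ring.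
Qed.

Lemma is_derive_Jker (R : realType) (t : R) : -1 < t < 1 ->
  is_derive t 1 Jker (dJker t).
Proof.
move=> /andP[t0 t1].
have d1 : is_derive t 1 (fun u => ln (1 + u)) (1 + t)^-1.
  by apply/is_derive_1D/is_derive1_ln; lra.
have d2 : is_derive t 1 (fun u => ln (1 - u)) (- (1 - t)^-1).
  by apply/is_derive_1B/is_derive1_ln; lra.
rewrite /Jker /dJker; apply: is_derive_eq; rewrite /GRing.scale /=; ring.
Qed.

Lemma is_derive_dJker (R : realType) (t : R) : -1 < t < 1 ->
  is_derive t 1 dJker ((1 - t ^+ 2) ^+ 2)^-1.
Proof.
move=> /andP[t0 t1].
have xp : 0 < 1 + t by lra.
have yp : 0 < 1 - t by lra.
have d1 : is_derive t 1 (fun u => ln (1 + u)) (1 + t)^-1.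
  by apply/is_derive_1D/is_derive1_ln.
have d2 : is_derive t 1 (fun u => ln (1 - u)) (- (1 - t)^-1).
  by apply/is_derive_1B/is_derive1_ln.
have dV (x : R) : 0 < x -> is_derive x 1 (fun u : R => u^-1) (- x ^- 2).
  move=> x0; apply: is_derive_eq.
    by apply: is_deriveV; rewrite gt_eqF.
  by rewrite /GRing.scale /= mulr1.
have d3 : is_derive t 1 (fun u => (1 + u)^-1) (- (1 + t) ^- 2).
  exact/(@is_derive_1D _ (fun u => u^-1))/dV.
have d4 : is_derive t 1 (fun u => (1 - u)^-1) (- - (1 - t) ^- 2).
  exact/(@is_derive_1B _ (fun u => u^-1))/dV.
rewrite /dJker; apply: is_derive_eq; rewrite /GRing.scale /=.
have -> : 1 - t ^+ 2 = (1 + t) * (1 - t) by ring.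
by field; rewrite !gt_eqF.
Qed.

Lemma powgen1 (R : realType) (s : R) : powgen s 1 = 0.
Proof. by rewrite /powgen ln1 powR1 subrr !mulr0 oppr0; do 2?case: ifP. Qed.

Lemma Wker_le_Jker (R : realType) (s t : R) :
  -2 <= s <= 0 -> -1 < t < 1 -> Wker s t <= Jker t.
Proof.
move=> hs ht; rewrite -subr_ge0.
apply: (@ge0_of_second_derivative _ (fun x => Jker x - Wker s x)
  (fun x => dJker x - dWker s x) (fun x => ((1 - x ^+ 2) ^+ 2)^-1 -
    ((1 + x) `^ (- s - 1) + (1 - x) `^ (- s - 1)) / 2) 1) => //.
- move=> x hx; have dJ := is_derive_Jker _ _ hx;
  have dW := is_derive_Wker _ s _ hx.
  exact: is_deriveB.
- move=> x hx; have dJ := is_derive_dJker _ _ hx;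
  have dW := is_derive_dWker _ s _ hx.
  exact: is_deriveB.
- by rewrite /Jker /Wker addr0 subr0 powgen1; ring.
- by rewrite /dJker /dWker addr0 subr0; ring.
- by move=> x hx; rewrite subr_ge0 powR_pair_le//; lra.
Qed.

Lemma Jker_le_Wker (R : realType) (s t : R) :
  1 <= s -> -1 < t < 1 -> Jker t <= Wker s t.
Proof.
move=> hs ht; rewrite -subr_ge0.
apply: (@ge0_of_second_derivative _ (fun x => Wker s x - Jker x)
  (fun x => dWker s x - dJker x) (fun x =>
    ((1 + x) `^ (- s - 1) + (1 - x) `^ (- s - 1)) / 2
    - ((1 - x ^+ 2) ^+ 2)^-1) 1) => //.
- move=> x hx; have dJ := is_derive_Jker _ _ hx;
  have dW := is_derive_Wker _ s _ hx.
  exact: is_deriveB.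
- move=> x hx; have dJ := is_derive_dJker _ _ hx;
  have dW := is_derive_dWker _ s _ hx.
  exact: is_deriveB.
- by rewrite /Jker /Wker addr0 subr0 powgen1; ring.
- by rewrite /dJker /dWker addr0 subr0; ring.
- by move=> x hx; rewrite subr_ge0 powR_pair_ge//; lra.
Qed.

(** * Reduction of the divergences to the kernels *)

Lemma midpoint_deviation (R : realType) (p q : R) : 0 < p -> 0 < q ->
  [/\ 0 < (p + q) / 2, -1 < (p - q) / (p + q) < 1,
      p = (p + q) / 2 * (1 + (p - q) / (p + q)) &
      q = (p + q) / 2 * (1 - (p - q) / (p + q))].
Proof.
move=> p0 q0; have pq : 0 < p + q by lra.
split; first lra.
- by rewrite ltr_pdivlMr// ltr_pdivrMr//; lra.
- by field; rewrite gt_eqF.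
- by field; rewrite gt_eqF.
Qed.

Lemma Jdiv_Jker (R : realType) (n : nat) (P Q : 'rV[R]_n) :
  Gamma R n P -> Gamma R n Q ->
  8^-1 * Jdiv P Q = \sum_(i < n) (P 0 i + Q 0 i) / 2 *
    Jker ((P 0 i - Q 0 i) / (P 0 i + Q 0 i)).
Proof.
move=> [P0 _] [Q0 _]; rewrite /Jdiv mulr_sumr; apply: eq_bigr => i _.
have [] := midpoint_deviation _ _ _ (P0 i) (Q0 i).
move: ((P 0 i + Q 0 i) / 2) ((P 0 i - Q 0 i) / (P 0 i + Q 0 i)) => m t
  m0 /andP[t0 t1] -> ->.
have xp : 0 < 1 + t by lra.
have yp : 0 < 1 - t by lra.
by rewrite /Jker ln_div ?posrE ?mulr_gt0// !lnM ?posrE//; field.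
Qed.

(** Outside s = 0, 1 the term - 1 of [Wdiv] is spread over the indices as minus
    the sum of the means (p_i + q_i) / 2; this is where P and Q must have total
    mass 1. *)
Lemma Wdiv_Wker (R : realType) (n : nat) (s : R) (P Q : 'rV[R]_n) :
  Gamma R n P -> Gamma R n Q ->
  Wdiv s P Q = \sum_(i < n) (P 0 i + Q 0 i) / 2 *
    Wker s ((P 0 i - Q 0 i) / (P 0 i + Q 0 i)).
Proof.
move=> [P0 P1] [Q0 Q1]; rewrite /Wdiv /Wker /powgen.
case: eqP => [_|/eqP s0].
  rewrite -big_split/= mulr_sumr; apply: eq_bigr => i _.
  have [] := midpoint_deviation _ _ _ (P0 i) (Q0 i).
  move: ((P 0 i + Q 0 i) / 2) ((P 0 i - Q 0 i) / (P 0 i + Q 0 i)) => m t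
    m0 /andP[t0 t1] -> ->.
  have -> : 2 * (m * (1 + t)) / (m * (1 + t) + m * (1 - t)) = 1 + t.
    by field; rewrite gt_eqF//; lra.
  have -> : 2 * (m * (1 - t)) / (m * (1 + t) + m * (1 - t)) = 1 - t.
    by field; rewrite gt_eqF//; lra.
  by field.
case: eqP => [_|/eqP s1].
  apply: eq_bigr => i _; congr (_ * _).
  have [] := midpoint_deviation _ _ _ (P0 i) (Q0 i).
  move: ((P 0 i + Q 0 i) / 2) ((P 0 i - Q 0 i) / (P 0 i + Q 0 i)) => m t
    m0 /andP[t0 t1] -> ->.
  have xp : 0 < 1 + t by lra.
  have yp : 0 < 1 - t by lra.
  have -> : m * (1 + t) + m * (1 - t) = 2 * m by ring.
  rewrite -powR12_sqrt; last by rewrite ltW// !mulr_gt0.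
  rewrite ln_div ?posrE ?mulr_gt0 ?powR_gt0 ?mulr_gt0//.
  rewrite !lnM ?posrE ?powR_gt0 ?mulr_gt0// ln_powR.
  by rewrite !lnM ?posrE ?mulr_gt0//; field.
have m1 : \sum_(i < n) (P 0 i + Q 0 i) / 2 = 1.
  by rewrite -mulr_suml big_split/= P1 Q1; field.
set k := (s * (s - 1))^-1; rewrite -[X in _ * (_ - X)]m1 -sumrB mulr_sumr.
apply: eq_bigr => i _.
have [] := midpoint_deviation _ _ _ (P0 i) (Q0 i).
move: ((P 0 i + Q 0 i) / 2) ((P 0 i - Q 0 i) / (P 0 i + Q 0 i)) => m t
  m0 /andP[t0 t1] -> ->.
have xp : 0 < 1 + t by lra.
have yp : 0 < 1 - t by lra.
have mE : m `^ (1 - s) = m / m `^ s.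
  by rewrite powRB ?powRr1 ?(ltW m0)// (gt_eqF m0) implybT.
rewrite !powRM ?(ltW m0) ?(ltW xp) ?(ltW yp)// mE /k; field.
by rewrite s0 subr_eq0 s1 gt_eqF// powR_gt0.
Qed.

Theorem mainTheorem9 (R : realType) (n : nat) (hn : (2 <= n)%N)
    (P Q : 'rV[R]_n) (hP : Gamma R n P) (hQ : Gamma R n Q) :
  (forall s : R, -2 <= s <= 0 -> Wdiv s P Q <= 8^-1 * Jdiv P Q) /\
  (forall s : R, 1 <= s -> 8^-1 * Jdiv P Q <= Wdiv s P Q).
Proof.
have [P0 _] := hP; have [Q0 _] := hQ.
rewrite Jdiv_Jker//; split=> s hs; rewrite Wdiv_Wker//;
  apply: ler_sum => i _;
  have [m0 ht _ _] := midpoint_deviation _ _ _ (P0 i) (Q0 i);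
  rewrite ler_pM2l//.
- exact: Wker_le_Jker.
- exact: Jker_le_Wker.
Qed.
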